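(* Let $V$ be a non-singular ordered vector space and $T\colon V\to V$ any positive linear map. For every $v\in V$ with $v\geq 0$, $v\neq 0$, whose orbit $\langle T\rangle v=\{T^n v : n\in\mathbf{N}\}$ is order-bounded, there is a positive linear functional $J$ on the orbit ideal $V_{\langle T\rangle v}$ and a scalar $t\geq 0$ such that $$J(Tu)=t\,J(u)\quad\text{for all } u\in V_{\langle T\rangle v},\qquad\text{and}\qquad J(v)=1.$$ Moreover, $J$ can be chosen such that $t\leq 1$.
   Context: Vector spaces are over $\mathbf{R}$, and $\mathbf{N}$ contains $0$. An ordered vector space is a real vector space $V$ with a partial order compatible with the linear structure (translation-invariant and invariant under multiplication by non-negative scalars); $V^+=\{v\in V: v\geq 0\}$. No topology on $V$ is assumed. A linear map $T\colon V\to V$ is positive if $T(V^+)\subseteq V^+$; a linear functional on a linear subspace of $V$ (with the induced order) is positive if it takes non-negative values on the elements $\geq 0$ of that subspace. $V$ is non-singular if for every $v\in V$ with $v\geq 0$, $v\neq 0$, there exists a positive linear functional on $V$ which is non-zero on $v$. A subset of $V$ is order-bounded here if it admits some upper bound in $V$, i.e. there is $w\in V$ with $a\leq w$ for all $a$ in the subset. The orbit ideal $V_{\langle T\rangle v}$ is the smallest vector subspace of $V$ that contains the orbit $\langle T\rangle v$ and is closed under order intervals (if $x\leq y\leq z$ with $x,z$ in the subspace, then $y$ is in the subspace). Equivalently, it consists of the $u\in V$ for which there are $a_1,\dots,a_q\in\langle T\rangle v$ with $\pm u\leq a_1+\cdots+a_q$; $T$ maps it to itself. *)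

(* Defs.v *)
From HB Require Import structures.
From mathcomp Require Import all_boot all_order all_algebra.
From mathcomp Require Import all_classical all_reals.

Set Implicit Arguments.
Unset Strict Implicit.
Unset Printing Implicit Defensive.

Import Order.TTheory GRing.Theory Num.Theory.
Local Open Scope classical_set_scope.
Local Open Scope ring_scope.

HB.mixin Record POrderedZmodule_Lmodule_isPOrderedLmodule
    (R : numDomainType) V of Num.POrderedZmodule V & GRing.Lmodule R V := {
  lev_add2l : forall z x y : V, x <= y -> z + x <= z + y;
  lev_wpscale2l : forall (a : R) (x y : V), 0 <= a -> x <= y -> a *: x <= a *: y
}.

#[short(type="porderLmodType")]
HB.structure Definition POrderedLmodule (R : numDomainType) :=
  { V of Num.POrderedZmodule V & GRing.Lmodule R V
       & POrderedZmodule_Lmodule_isPOrderedLmodule R V }.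

Section OrderedVectorSpace.
Context {R : realType} {V : porderLmodType R}.

Definition positive_map (T : V -> V) : Prop := forall x, 0 <= x -> 0 <= T x.

(* A functional on a linear subspace [E] is represented by a function on all
   of [V] whose values outside [E] are irrelevant; [E] carries the induced
   order. *)
Definition linear_functional_on (E : set V) (J : V -> R) : Prop :=
  forall (a : R) (x y : V), E x -> E y -> J (a *: x + y) = a * J x + J y.

Definition positive_functional_on (E : set V) (J : V -> R) : Prop :=
  linear_functional_on E J /\ (forall x, E x -> 0 <= x -> 0 <= J x).

Definition order_ideal (E : set V) : Prop :=
  submod_closed (mem E) /\
  (forall x y z, E x -> E z -> x <= y -> y <= z -> E y).

Definition iter_orbit (T : V -> V) (v : V) : set V := range (fun n => iter n T v).

Definition orbit_ideal (T : V -> V) (v : V) : set V :=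
  smallest order_ideal (iter_orbit T v).

Lemma order_ideal_orbit_ideal (T : V -> V) (v : V) : order_ideal (orbit_ideal T v).
Proof.
split; first split.
- by apply/mem_set => E [[[/set_mem]]].
- move=> a x y /set_mem xI /set_mem yI; apply/mem_set => E EI.
  have [[[_ +] _] _] := EI.
  by move=> /(_ a x y (mem_set (xI E EI)) (mem_set (yI E EI))) /set_mem.
- move=> x y z xI zI xy yz E EI; have [[_ +] _] := EI.
  by apply; [exact: xI EI | exact: zI EI | |].
Qed.

Lemma iter_orbit_ideal (T : V -> V) (v : V) (n : nat) :
  orbit_ideal T v (iter n T v).
Proof. by move=> E [_]; apply; exists n. Qed.

Lemma orbit_ideal_stable (T : {linear V -> V}) (v : V) : positive_map T ->
  forall u, orbit_ideal T v u -> orbit_ideal T v (T u).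
Proof.
move=> T0 u uI.
have Tle x y : x <= y -> T x <= T y.
  move=> xy; have := lev_add2l (- x) _ _ xy; rewrite addNr => /T0.
  by rewrite linearD linearN => /(lev_add2l (T x)); rewrite addr0 addNKr.
have [[I0 Ilin] Iconv] := order_ideal_orbit_ideal T v.
apply: (uI (T @^-1` orbit_ideal T v)); split; first split; first split.
- by apply/mem_set; rewrite /= linear0; exact: set_mem.
- move=> a x y /set_mem xI /set_mem yI; apply/mem_set; rewrite /= linearP.
  by apply/set_mem/Ilin; exact: mem_set.
- by move=> x y z xI zI /Tle xy /Tle yz; exact: (Iconv (T x) _ (T z)).
- by move=> _ [n _ <-]; exact: (@iter_orbit_ideal T v n.+1).
Qed.

End OrderedVectorSpace.

Definition nonsingular (R : realType) (V : porderLmodType R) : Prop :=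
  forall v : V, 0 <= v -> v != 0 ->
    exists J : {scalar V}, (forall x, 0 <= x -> 0 <= J x) /\ J v != 0.

(* Main.v *)
Require Import Defs.
From mathcomp Require Import all_boot all_order all_algebra.
From mathcomp Require Import all_classical all_reals.
From mathcomp Require Import topology normedtype sequences.
From mathcomp Require Import lra.
Import Order.TTheory GRing.Theory Num.Theory.
Import numFieldNormedType.Exports.
Local Open Scope classical_set_scope.
Local Open Scope ring_scope.

(** Nonsingularity gives a positive functional [phi] with [phi v > 0], and
the order bound makes the sequence [f n = phi (T^n v)] bounded.  Its growth
rate [t], the infimum of the [s > 0] with [f n = O(s^n)], lies in [[0, 1]] and
is the eigenvalue.

Weighted sums [F u = sum_n mu_n phi (T^n u)] are positive functionals on the
orbit ideal when [sum_n mu_n f n] converges and the ratios [mu_n / mu_(n+1)]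
are bounded. Replacing [u] by [T u] shifts the weights, so [F] is nearly an
eigenfunctional for [t] when these ratios stay close to [t], up to the
boundary term [mu_0 phi u]. The obvious choice [mu_n = a^-n], with [a]
slightly above [t], makes the sum converge, but when [a] tends to [t] the sum
may stay bounded and then the boundary term does not disappear after
normalisation. As in Patterson's construction of conformal measures, the
weights are therefore made to grow faster for a while: for [t > 0], take [mu_n
= min (b^-n, K a^-n)] with [0 < b < t < a]. By definition of [t] the sequence
[b^-n f n] is unbounded, so a suitable [K] makes the sum as large as desired
([exists_slow_weights]).

After the normalisation [F v = 1] these approximate eigenfunctionals
([weighted_sum_approx_eigen]) are bounded at each point of the ideal
([approx_eigen_bounded]), and their limit along an ultrafilter is an exact one
([exists_eigen_of_approx]).  The error estimates are inequalities on positive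
vectors; this is enough because such vectors span the ideal
([eigen_on_dominated]). *)

(** * Limits and series *)

Lemma bounded_ultra_cvg {I : Type} {R : realType} (G : set_system I)
    (f : I -> R) (M : R) :
  UltraFilter G -> (forall i, `|f i| <= M) -> cvg (f @ G).
Proof.
move=> UG fM.
have fGM : (f @ G) `[(- M), M]%classic.
  apply: (@filterS _ G _ setT); last exact: filterT.
  by move=> i _ /=; rewrite in_itv /= -ler_norml fM.
have [p [_ pcl]] := @segment_compact R (- M) M (f @ G) _ fGM.
apply/cvg_ex; exists p => A Ap.
have [//|GnA] := in_ultra_setVsetC (f @^-1` A) UG.
by have [y [nAy /nAy]] := pcl (~` A) A GnA Ap.
Qed.

Lemma is_cvg_series_shift {R : realType} {y : R ^nat} : cvgn (series y) ->
  series (fun n => y n.+1) @ \oo --> limn (series y) - y 0%N.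
Proof.
move=> cy.
have -> : series (fun n => y n.+1) = (fun n => series y n.+1 - y 0%N).
  apply/funext => n; rewrite /series /= big_nat_recl //=.
  by rewrite [in RHS]addrC addKr.
by apply: cvgB; [rewrite cvg_shiftS; exact: cy | exact: cvg_cst].
Qed.

Lemma le_term_lim_series {R : realType} (y : R ^nat) (n : nat) :
  (forall n, 0 <= y n) -> cvgn (series y) -> y n <= limn (series y).
Proof.
move=> y0 cy; apply: le_trans (nondecreasing_cvgn_le _ cy n.+1).
  by rewrite /series /= big_nat_recr //= lerDr sumr_ge0.
apply/nondecreasing_seqP => k.
by rewrite /series /= big_nat_recr //= lerDl.
Qed.

Lemma mulr_exprVS {R : realType} (x : R) (n : nat) : 0 < x ->
  x * x ^- n.+1 = x ^- n.
Proof. by move=> x0; rewrite exprS invfM mulrA divff ?mul1r // gt_eqF. Qed.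

(** * Slowly varying weights *)

Definition growth_ratios {R : realType} (f : R ^nat) : set R :=
  [set s | 0 < s /\ exists C, forall n, f n <= C * s ^+ n].

(** The last condition bounds what is lost at index [0] when the weights are
shifted; it is relative to the normalisation of the sum to [1]. *)
Definition slow_weights {R : realType} (t eps : R) (mu f : R ^nat) : Prop :=
  [/\ forall n, 0 <= mu n,
      forall n, (t - eps) * mu n.+1 <= mu n <= (t + eps) * mu n.+1,
      cvgn (series (fun n => mu n * f n)),
      limn (series (fun n => mu n * f n)) = 1
    & t * mu 0%N <= eps].

Section Weights.
Context {R : realType} (f : R ^nat).
Hypothesis f0 : forall n, 0 <= f n.

Lemma is_cvg_series_above_growth (s a : R) : growth_ratios f s -> s < a ->
  cvgn (series (fun n => a ^- n * f n)).
Proof.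
move=> [s0 [C fC]] sa; have a0 : 0 < a by exact: lt_trans sa.
have C0 : 0 <= C by have := fC 0%N; rewrite expr0 mulr1; exact: le_trans.
have ge0 n : 0 <= a ^- n by rewrite invr_ge0 exprn_ge0 // ltW.
apply: (series_le_cvg (v_ := geometric C (s / a))).
- by move=> n; rewrite mulr_ge0.
- by move=> n; rewrite mulr_ge0 // exprn_ge0 // divr_ge0 // ltW.
- move=> n; rewrite /= expr_div_n mulrA [leRHS]mulrC.
  exact: ler_wpM2l.
- apply: is_cvg_geometric_series.
  by rewrite ger0_norm ?divr_ge0 ?ltW // ltr_pdivrMr // mul1r.
Qed.

(** Dividing by the sum turns the boundary condition, stated relative to that
sum, into the one of [slow_weights]. *)
Lemma normalize_weights (t eps : R) (mu : R ^nat) :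
  (forall n, 0 <= mu n) ->
  (forall n, (t - eps) * mu n.+1 <= mu n <= (t + eps) * mu n.+1) ->
  cvgn (series (fun n => mu n * f n)) ->
  0 < limn (series (fun n => mu n * f n)) ->
  t * mu 0%N <= eps * limn (series (fun n => mu n * f n)) ->
  exists nu, slow_weights t eps nu f.
Proof.
move=> mu0 mur cmu.
set S := limn _ => S0 tS.
have iS0 : 0 <= S^-1 by rewrite invr_ge0 ltW.
exists (fun n => S^-1 * mu n).
have E : (fun n => S^-1 * mu n * f n) = S^-1 *: (fun n => mu n * f n).
  by apply/funext => n; rewrite -mulrA.
split.
- by move=> n; rewrite mulr_ge0.
- move=> n; have /andP[h1 h2] := mur n.
  by rewrite !(mulrCA _ S^-1) !ler_wpM2l.
- by rewrite E; exact: is_cvg_seriesZ.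
- by rewrite E lim_seriesZ // -/S /GRing.scale /= mulVf // gt_eqF.
- by rewrite mulrCA mulrC ler_pdivrMr.
Qed.

Lemma growth_ratios1 (B : R) : (forall n, f n <= B) -> growth_ratios f 1.
Proof. by move=> fB; split => //; exists B => n; rewrite expr1n mulr1. Qed.

(** For [t = 0] purely geometric weights work, as the boundary condition is
trivial.  For [t > 0], ratios above [t] at infinity make the sum converge, and
ratios below [t] on a long initial segment make it large. *)
Lemma exists_slow_weights (B eps : R) : 0 < f 0%N -> (forall n, f n <= B) ->
  0 < eps -> exists mu, slow_weights (inf (growth_ratios f)) eps mu f.
Proof.
move=> f00 fB; move: eps.
have lb0 : lbound (growth_ratios f) 0 by move=> s [/ltW].
have r1 := growth_ratios1 _ fB.
have hi : has_inf (growth_ratios f) by split; [exists 1|exists 0].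
set t := inf _.
have t0 : 0 <= t by apply: lb_le_inf => //; exists 1.
have cvga a : t < a -> cvgn (series (fun n => a ^- n * f n)).
  move=> ta; have [|s rs sa] := @inf_adherent _ _ (a - t) _ hi.
    by rewrite subr_gt0.
  by apply: is_cvg_series_above_growth rs _; rewrite addrC subrK in sa.
(* A smaller [eps] gives a stronger conclusion, so for [t > 0] one may take
   [eps < t], which keeps the lower ratio [t - eps] positive. *)
have weaken e eps mu : e <= eps -> slow_weights t e mu f ->
    slow_weights t eps mu f.
  move=> le [mu0 mur cmu lmu tmu]; split => //; last exact: le_trans tmu le.
  move=> n; have /andP[h1 h2] := mur n; apply/andP; split.
    by apply: le_trans h1; rewrite ler_wpM2r // lerB.
  by apply: le_trans h2 _; rewrite ler_wpM2r // lerD.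
case: (eqVneq t 0) => [t_eq0|tN0] eps e0.
- apply: (@normalize_weights _ _ (fun n => eps ^- n)) => //.
  + by move=> n; rewrite invr_ge0 exprn_ge0 // ltW.
  + move=> n; rewrite t_eq0 sub0r add0r mulNr mulr_exprVS // lexx andbT.
    by apply: (@le_trans _ _ 0); rewrite ?oppr_le0 invr_ge0 exprn_ge0 // ltW.
  + by apply: cvga; rewrite t_eq0.
  + apply: lt_le_trans (le_term_lim_series _ 0%N _ _); rewrite /= ?t_eq0 //.
    * by rewrite expr0 invr1 mul1r.
    * by move=> n; rewrite mulr_ge0 // invr_ge0 exprn_ge0 // ltW.
    * by apply: cvga; rewrite t_eq0.
  + rewrite t_eq0 mul0r mulr_ge0 ?(ltW e0) //.
    apply: limr_ge; first by apply: cvga; rewrite t_eq0.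
    apply: nearW => n; apply: sumr_ge0 => i _.
    by rewrite mulr_ge0 // invr_ge0 exprn_ge0 // ltW.
have tp : 0 < t by rewrite lt_def tN0.
pose e := Num.min eps (t / 2).
have [e_gt0 et] : 0 < e /\ e < t.
  by rewrite /e; case: (leP eps (t/2)) => h; split; lra.
suff [mu hmu] : exists mu, slow_weights t e mu f.
  by exists mu; apply: weaken hmu; rewrite /e ge_min lexx.
pose a := t + e; pose b := t - e.
have b0 : 0 < b by rewrite /b; lra.
have a0 : 0 < a by rewrite /a; lra.
have ba : b <= a by rewrite /a /b; lra.
have M0 : 0 < t / e by rewrite divr_gt0.
have [N fN] : exists N, t / e * b ^+ N < f N.
  apply: contrapT => nN.
  have /(ge_inf hi.2) : growth_ratios f b.
    split => //; exists (t / e) => n; rewrite leNgt; apply/negP => h.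
    by apply: nN; exists n.
  rewrite -/t /b; lra.
pose K := (a / b) ^+ N.
have K0 : 0 <= K by rewrite exprn_ge0 // divr_ge0 // ltW.
(* Shape of the weights: [b^-n] up to [N], then a multiple of [a^-n]. *)
pose mu := fun n => Num.min (b ^- n) (K * a ^- n).
have bn n : 0 <= b ^- n by rewrite invr_ge0 exprn_ge0 // ltW.
have an n : 0 <= a ^- n by rewrite invr_ge0 exprn_ge0 // ltW.
have mu0 n : 0 <= mu n by rewrite /mu le_min bn mulr_ge0.
have cmu : cvgn (series (fun n => mu n * f n)).
  apply: (series_le_cvg (v_ := fun n => K * a ^- n * f n)).
  - by move=> n; rewrite mulr_ge0.
  - by move=> n; rewrite mulr_ge0 // mulr_ge0.
  - by move=> n; rewrite ler_wpM2r // /mu ge_min lexx orbT.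
  - have -> : (fun n => K * a ^- n * f n) = K *: (fun n => a ^- n * f n).
      by apply/funext => n; rewrite -mulrA.
    by apply: is_cvg_seriesZ; apply: cvga; rewrite /a; lra.
(* The constant [K] makes the two geometric branches of [mu] meet at [N], so
   that the single term of index [N] is already at least [t / e]. *)
have SN : t / e <= limn (series (fun n => mu n * f n)).
  apply: le_trans (le_term_lim_series _ N _ cmu); last first.
    by move=> n; rewrite mulr_ge0.
  have -> : mu N = b ^- N.
    rewrite /mu /K expr_div_n mulrAC divff ?mul1r ?minxx //.
    by rewrite expf_neq0 // gt_eqF.
  by rewrite [leRHS]mulrC ler_pdivlMr ?exprn_gt0 // ltW.
apply: (@normalize_weights _ _ mu) => //.
- move=> n; rewrite -/a -/b /mu; apply/andP; split.
    rewrite le_min; apply/andP; split.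
      by rewrite -(mulr_exprVS _ n b0) ler_wpM2l ?(ltW b0) // ge_min lexx.
    apply: (@le_trans _ _ (b * (K * a ^- n.+1))).
      by rewrite ler_wpM2l ?(ltW b0) // ge_min lexx orbT.
    rewrite -(mulr_exprVS _ n a0) [leRHS]mulrCA ler_wpM2r //.
    exact: mulr_ge0.
  rewrite minr_pMr ?(ltW a0) // le_min !ge_min; apply/andP; split.
    by rewrite -(mulr_exprVS _ n b0) ler_wpM2r.
  by rewrite mulrCA mulr_exprVS // lexx orbT.
- exact: lt_le_trans SN.
- apply: (@le_trans _ _ t).
    by rewrite ler_piMr // /mu ge_min expr0 invr1 lexx.
  by rewrite mulrC -ler_pdivrMr.
Qed.

End Weights.

(** * Ordered vector spaces and the orbit ideal *)

Section OrderFacts.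
Context {R : realType} {V : porderLmodType R}.
Implicit Types x y z : V.

Lemma subv_ge0 x y : (0 <= y - x) = (x <= y).
Proof.
apply/idP/idP => [/(lev_add2l x)|/(lev_add2l (- x))].
  by rewrite addr0 addrC subrK.
by rewrite addNr addrC.
Qed.

Lemma addv_ge0 x y : 0 <= x -> 0 <= y -> 0 <= x + y.
Proof. by move=> x0 /(lev_add2l x); rewrite addr0; exact: le_trans. Qed.

Lemma scalev_ge0 (a : R) x : 0 <= a -> 0 <= x -> 0 <= a *: x.
Proof. by move=> a0 /(lev_wpscale2l _ _ _ a0); rewrite scaler0. Qed.

Lemma levD x y x' y' : x <= y -> x' <= y' -> x + x' <= y + y'.
Proof.
move=> h h'; apply: (@le_trans _ _ (x + y')); first exact: lev_add2l.
by rewrite ![_ + y']addrC; exact: lev_add2l.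
Qed.

Lemma levN x y : x <= y -> - y <= - x.
Proof. by rewrite -(subv_ge0 x) -(subv_ge0 (- y)) opprK addrC. Qed.

End OrderFacts.

Section Orbit.
Context {R : realType} {V : porderLmodType R} (T : {linear V -> V}) (v : V).
Hypotheses (T_ge0 : positive_map T) (v_ge0 : 0 <= v).

Inductive orbit_cone : V -> Prop :=
| orbit_cone_iter n : orbit_cone (iter n T v)
| orbit_cone_add x y : orbit_cone x -> orbit_cone y -> orbit_cone (x + y)
| orbit_cone_scale (a : R) x : 0 <= a -> orbit_cone x -> orbit_cone (a *: x).

(** The description of the orbit ideal by finite sums of orbit points; unlike
the intersection of all ideals, it exhibits a bound that estimates can use. *)
Definition dominated (u : V) : Prop :=
  exists2 e, orbit_cone e & - e <= u <= e.

Lemma iter_linear n (a : R) x y :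
  iter n T (a *: x + y) = a *: iter n T x + iter n T y.
Proof. by elim: n => //= n ->; rewrite linearP. Qed.

Lemma iterB n x y : iter n T (x - y) = iter n T x - iter n T y.
Proof. by elim: n => //= n ->; rewrite linearB. Qed.

Lemma iterZ n (a : R) x : iter n T (a *: x) = a *: iter n T x.
Proof. by elim: n => //= n ->; rewrite linearZ. Qed.

Lemma iter_ge0 n x : 0 <= x -> 0 <= iter n T x.
Proof. by move=> x0; elim: n => //= n; exact: T_ge0. Qed.

Lemma orbit_cone_ge0 e : orbit_cone e -> 0 <= e.
Proof.
elim=> [n|x y _ x0 _ y0|a x a0 _ x0]; first exact: iter_ge0.
- exact: addv_ge0.
- exact: scalev_ge0.
Qed.

Lemma orbit_cone_map e : orbit_cone e -> orbit_cone (T e).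
Proof.
elim=> [n|x y _ Tx _ Ty|a x a0 _ Tx].
- exact: (orbit_cone_iter n.+1).
- by rewrite linearD; exact: orbit_cone_add.
- by rewrite linearZ; exact: orbit_cone_scale.
Qed.

Lemma dominated_cone e : orbit_cone e -> dominated e.
Proof.
move=> ce; have e0 := orbit_cone_ge0 _ ce; exists e => //; rewrite lexx andbT.
by apply: le_trans (e0); rewrite -oppr0; exact: levN _ _ e0.
Qed.

Lemma dominatedD x y : dominated x -> dominated y -> dominated (x + y).
Proof.
move=> [e ce /andP[ex xe]] [f cf /andP[fy yf]]; exists (e + f).
  exact: orbit_cone_add.
by rewrite opprD !levD.
Qed.

Lemma dominatedN x : dominated x -> dominated (- x).
Proof.
move=> [e ce /andP[ex xe]]; exists e => //; apply/andP; split; first exact: levN.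
by rewrite -[leRHS]opprK; exact: levN.
Qed.

Lemma dominatedZ (a : R) x : dominated x -> dominated (a *: x).
Proof.
have pos (b : R) y : 0 <= b -> dominated y -> dominated (b *: y).
  move=> b0 [e ce /andP[ey ye]]; exists (b *: e); first exact: orbit_cone_scale.
  by rewrite -scalerN !lev_wpscale2l.
have [a0|a0] := leP 0 a; first exact: pos.
move=> dx; rewrite -(opprK a) scaleNr; apply/dominatedN/pos => //.
by rewrite oppr_ge0 ltW.
Qed.

Lemma order_ideal_dominated : order_ideal (dominated : set V).
Proof.
split; first split.
- apply/mem_set; have /dominatedZ := dominated_cone _ (orbit_cone_iter 0).
  by move=> /(_ 0); rewrite scale0r.
- move=> a x y /set_mem dx /set_mem dy; apply/mem_set.
  by apply: dominatedD => //; exact: dominatedZ.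
- move=> x y z [e ce /andP[ex xe]] [f cf /andP[fz zf]] xy yz.
  exists (e + f); first exact: orbit_cone_add.
  have e0 := orbit_cone_ge0 _ ce; have f0 := orbit_cone_ge0 _ cf.
  apply/andP; split.
    apply: le_trans xy; apply: le_trans ex; apply: levN.
    by rewrite -[leLHS]addr0; exact: lev_add2l.
  apply: le_trans yz _; apply: le_trans zf _.
  by rewrite addrC -[leLHS]addr0; exact: lev_add2l.
Qed.

Lemma orbit_ideal_dominated u : orbit_ideal T v u -> dominated u.
Proof.
move=> uI; apply: (uI dominated); split; first exact: order_ideal_dominated.
by move=> _ [n _ <-]; apply: dominated_cone; exact: orbit_cone_iter.
Qed.

Lemma dominated_map u : dominated u -> dominated (T u).
Proof.
have Tle x y : x <= y -> T x <= T y.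
  by move=> xy; rewrite -subv_ge0 -linearB T_ge0 // subv_ge0.
move=> [e ce /andP[/Tle eu /Tle ue]]; exists (T e); first exact: orbit_cone_map.
by rewrite -linearN eu.
Qed.

(** If [u <= e] with [e] in the orbit cone, then [u = e - (e - u)] is a
difference of positive dominated vectors. *)
Lemma eigen_on_dominated (J : V -> R) (t : R) :
  linear_functional_on dominated J ->
  (forall x, dominated x -> 0 <= x -> J (T x) = t * J x) ->
  forall u, dominated u -> J (T u) = t * J u.
Proof.
move=> Jlin Jpos u du; have [e ce /andP[_ ue]] := du.
have de := dominated_cone _ ce.
have dd : dominated (e - u) by apply: dominatedD => //; exact: dominatedN.
have JB x y : dominated x -> dominated y -> J (y - x) = J y - J x.
  by move=> dx dy; rewrite addrC -scaleN1r Jlin // mulN1r addrC.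
rewrite -[u in LHS](subKr e) linearB JB; try exact: dominated_map.
rewrite !Jpos ?subv_ge0 //; last exact: orbit_cone_ge0.
by rewrite -mulrBr -JB // subKr.
Qed.

(** * Approximate eigenfunctionals *)

(** Two-sided estimates on positive vectors only, so that no absolute value has
to be controlled.  The term [eps * phi x] absorbs the boundary term of the
shifted sums. *)
Definition approx_eigen (phi : V -> R) (t eps : R) (F : V -> R) : Prop :=
  [/\ linear_functional_on dominated F,
      forall x, dominated x -> 0 <= x -> 0 <= F x,
      F v = 1
    & forall x, dominated x -> 0 <= x ->
        (t - eps) * F x - eps * phi x <= F (T x) <= (t + eps) * F x].

Section WeightedSum.
Context (phi : {scalar V}).
Hypothesis phi_ge0 : forall x, 0 <= x -> 0 <= phi x.
Context {t eps : R} {mu : R ^nat}.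
Hypothesis t_ge0 : 0 <= t.
Hypothesis slow_mu : slow_weights t eps mu (fun n => phi (iter n T v)).

Let term (u : V) : R ^nat := fun n => mu n * phi (iter n T u).
Let F (u : V) : R := limn (series (term u)).

Let mu_ge0 n : 0 <= mu n. Proof. by case: slow_mu. Qed.

Let term_ge0 x n : 0 <= x -> 0 <= term x n.
Proof. by move=> x0; rewrite mulr_ge0 // phi_ge0 // iter_ge0. Qed.

Let termP (a : R) x y : term (a *: x + y) = a *: term x + term y.
Proof.
apply/funext => n.
by rewrite /term iter_linear linearP mulrDr mulrCA.
Qed.

Let term_map_bounds x n : 0 <= x ->
  (t - eps) * term x n.+1 <= term (T x) n <= (t + eps) * term x n.+1.
Proof.
move=> x0; have [_ /(_ n)/andP[lo hi] _ _ _] := slow_mu.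
by rewrite /term -iterSr !mulrA !ler_wpM2r // phi_ge0 // iter_ge0.
Qed.

(* Convergence passes from [x] to [T x] because [mu_n] is at most a
   constant multiple of [mu_(n+1)]. *)
Let cvg_iter k : cvgn (series (term (iter k T v))).
Proof.
elim: k => [|k IH]; first by case: slow_mu.
have x0 := iter_ge0 k _ v_ge0.
apply: (series_le_cvg (v_ := (t + eps) *: (fun n => term (iter k T v) n.+1))).
- by move=> n; apply: term_ge0; exact: iter_ge0.
- move=> n; have /andP[_] := term_map_bounds _ n x0; apply: le_trans.
  by apply: term_ge0; exact: T_ge0.
- by move=> n; have /andP[_] := term_map_bounds _ n x0.
- by apply: is_cvg_seriesZ; apply/cvg_ex; eexists; exact: is_cvg_series_shift.
Qed.

Let cvg_cone e : orbit_cone e -> cvgn (series (term e)).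
Proof.
elim=> [k|x y _ cx _ cy|a x a0 _ cx]; first exact: cvg_iter.
- have -> : term (x + y) = term x + term y.
    by rewrite -[x in LHS]scale1r termP scale1r.
  exact: is_cvg_seriesD.
- have -> : term (a *: x) = a *: term x.
    by apply/funext => n; rewrite /term iterZ linearZ mulrCA.
  exact: is_cvg_seriesZ.
Qed.

Let cvg_dominated u : dominated u -> cvgn (series (term u)).
Proof.
move=> [e ce /andP[eu ue]]; apply: normed_cvg.
apply: (series_le_cvg (v_ := term e)) (cvg_cone _ ce) => n.
- exact: normr_ge0.
- by apply: term_ge0; exact: orbit_cone_ge0.
- have le x y : x <= y -> term x n <= term y n.
    move=> xy; rewrite ler_wpM2l // -subr_ge0 -linearB -iterB.
    by rewrite phi_ge0 // iter_ge0 // subv_ge0.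
  rewrite /= ler_norml le // andbT.
  apply: le_trans (le _ _ eu); rewrite /term.
  by rewrite -[- e]scaleN1r iterZ scaleN1r linearN mulrN.
Qed.

(** Comparing [F (T x)] term by term with the shifted sum [F x - mu_0 phi x]
gives both estimates; [t * mu_0 <= eps] controls the lost term. *)
Lemma weighted_sum_approx_eigen : approx_eigen phi t eps F.
Proof.
have [_ _ _ Fv tmu0] := slow_mu; split => //.
- move=> a x y dx dy; have cx := cvg_dominated _ dx.
  have cy := cvg_dominated _ dy.
  rewrite /F termP lim_seriesD //; last exact: is_cvg_seriesZ.
  by rewrite lim_seriesZ.
- move=> x dx x0; apply: limr_ge; first exact: cvg_dominated.
  by apply: nearW => n; apply: sumr_ge0 => i _; exact: term_ge0.
- move=> x dx x0.
  have cx := cvg_dominated _ dx; have cTx := cvg_dominated _ (dominated_map _ dx).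
  have shift := is_cvg_series_shift cx.
  have cshift := cvgP _ shift.
  have px := phi_ge0 _ x0.
  have mu0 := mu_ge0 0%N.
  have zero : 0 <= term x 0%N by exact: term_ge0.
  have Fge : 0 <= limn (series (fun n => term x n.+1)).
    apply: limr_ge => //.
    by apply: nearW => n; apply: sumr_ge0 => i _; exact: term_ge0.
  have /cvg_lim shiftE := shift.
  have {shiftE}shiftE := shiftE (@Rhausdorff R).
  have lo : (t - eps) * (F x - term x 0%N) <= F (T x).
    rewrite -shiftE -[_ * _]/(_ *: _) -lim_seriesZ //.
    apply: lim_series_le => //; first exact: is_cvg_seriesZ.
    by move=> n; have /andP[] := term_map_bounds _ n x0.
  have hi : F (T x) <= (t + eps) * (F x - term x 0%N).
    rewrite -shiftE -[_ * _]/(_ *: _) -lim_seriesZ //.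
    apply: lim_series_le => //; first exact: is_cvg_seriesZ.
    by move=> n; have /andP[] := term_map_bounds _ n x0.
  have e0 : 0 <= eps by apply: le_trans tmu0; rewrite mulr_ge0.
  have h1 : t * term x 0%N <= eps * phi x.
    by rewrite mulrA ler_wpM2r.
  have h2 : 0 <= eps * term x 0%N by rewrite mulr_ge0.
  have h3 : 0 <= t * term x 0%N by rewrite mulr_ge0.
  apply/andP; split; lra.
Qed.

End WeightedSum.

Lemma approx_eigenB {phi t eps F} (x y : V) : approx_eigen phi t eps F ->
  dominated x -> dominated y -> F (y - x) = F y - F x.
Proof.
by move=> [Flin _ _ _] dx dy; rewrite addrC -scaleN1r Flin // mulN1r addrC.
Qed.

(** Uniformity in [eps] and [F] is what makes pointwise limits possible.  On the
orbit, [F (T^k v) <= (t + 1)^k] by iterating the upper estimate from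
[F v = 1]; the cone and the dominated vectors follow. *)
Lemma approx_eigen_bounded (phi : V -> R) (t : R) (u : V) :
  (forall x, 0 <= x -> 0 <= phi x) -> 0 <= t -> dominated u ->
  exists M, forall eps F, eps <= 1 -> approx_eigen phi t eps F -> `|F u| <= M.
Proof.
move=> phi0 t0.
have cone e : orbit_cone e ->
    exists M, forall eps F, eps <= 1 -> approx_eigen phi t eps F -> F e <= M.
  elim=> [k|x y cx [M xM] cy [N yN]|a x a0 cx [M xM]].
  - exists ((t + 1) ^+ k) => eps F e1 [_ F0 Fv FT].
    elim: k => [|k IH]; first by rewrite /= Fv.
    have dk := dominated_cone _ (orbit_cone_iter k).
    have k0 := iter_ge0 k _ v_ge0.
    have /andP[_] := FT _ dk k0; move/le_trans; apply; rewrite exprS.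
    have Fk := F0 _ dk k0.
    apply: (@le_trans _ _ ((t + 1) * F (iter k T v))).
      by rewrite ler_wpM2r // lerD2l.
    by rewrite ler_wpM2l // addr_ge0.
  - exists (M + N) => eps F e1 aF; have [Flin _ _ _] := aF.
    rewrite -[x]scale1r Flin ?mul1r; try exact: dominated_cone.
    by rewrite lerD ?(xM eps) ?(yN eps).
  - exists (a * M) => eps F e1 aF; have [Flin _ _ _] := aF.
    have dx := dominated_cone _ cx.
    have Fz : F 0 = 0 by rewrite -(subrr x) (approx_eigenB _ _ aF) // subrr.
    have d0 : dominated 0 by rewrite -(scale0r x); exact: dominatedZ.
    by rewrite -[_ *: _]addr0 Flin // Fz addr0 ler_wpM2l // (xM eps).
move=> du; have [e ce /andP[eu ue]] := du.
have [M eM] := cone _ ce; exists M => eps F e1 aF.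
have [_ F0 _ _] := aF; have de := dominated_cone _ ce.
have := F0 _ (dominatedD _ _ de (dominatedN _ du)).
rewrite subv_ge0 (approx_eigenB _ _ aF) // => /(_ ue) up.
have := F0 _ (dominatedD _ _ du (dominatedN _ (dominatedN _ de))).
rewrite subv_ge0 => /(_ eu); rewrite opprK => lo.
have FN : F (- e) = - F e.
  have [Flin _ _ _] := aF.
  have d0 : dominated (e - e) by apply: dominatedD => //; exact: dominatedN.
  rewrite -[- e]add0r (approx_eigenB _ _ aF) //; last by rewrite -(subrr e).
  by rewrite -(subrr e) (approx_eigenB _ _ aF) // subrr sub0r.
move: lo; rewrite -[e in F (u + e)]opprK (approx_eigenB _ _ aF) //; last first.
  exact: dominatedN.
rewrite FN => lo; have := eM _ _ e1 aF => le.
by rewrite ler_norml; apply/andP; split; lra.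
Qed.

(** Pointwise boundedness lets the functionals converge along one ultrafilter at
every dominated vector at once; linearity, positivity and normalisation
survive the limit, while the errors vanish. *)
Lemma exists_eigen_of_approx (phi : V -> R) (t : R) :
  (forall x, 0 <= x -> 0 <= phi x) -> 0 <= t ->
  (forall eps, 0 < eps -> exists F, approx_eigen phi t eps F) ->
  exists J, [/\ linear_functional_on dominated J,
    forall x, dominated x -> 0 <= x -> 0 <= J x,
    J v = 1 & forall u, dominated u -> J (T u) = t * J u].
Proof.
move=> phi0 t0 ex.
have [F_ aF] : {F_ : nat -> V -> R &
    forall m, approx_eigen phi t (harmonic m) (F_ m)}.
  apply: (@choice _ _ (fun m => approx_eigen phi t (harmonic m))) => m.
  by apply: ex; rewrite /= invr_gt0 ltr0n.
have [G [UG oG]] := @ultraFilterLemma nat \oo _.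
pose J u := lim (F_ m u @[m --> G]).
have cJ u : dominated u -> F_ m u @[m --> G] --> J u.
  move=> du; have [M uM] := approx_eigen_bounded _ _ _ phi0 t0 du.
  apply: (bounded_ultra_cvg _ _ M) => m; apply: uM (aF m).
  by rewrite /= invf_le1 // ler1n.
have h0 : harmonic m @[m --> G] --> (0 : R).
  by apply: cvg_trans (@cvg_harmonic R) => A /oG.
have Jlin : linear_functional_on dominated J.
  move=> a x y dx dy; apply/(cvg_lim (@Rhausdorff R)).
  have -> : (fun m => F_ m (a *: x + y)) = (fun m => a * F_ m x + F_ m y).
    by apply/funext => m; have [-> //] := aF m.
  by apply: cvgD; [apply: cvgMr; exact: cJ|exact: cJ].
exists J; split => //.
- move=> x dx x0; apply: limr_ge; first by apply: cvgP; exact: cJ.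
  by apply: nearW => m; have [_ + _ _] := aF m; exact.
- apply/(cvg_lim (@Rhausdorff R)).
  have -> : (fun m => F_ m v) = (fun=> 1) by apply/funext => m; have [] := aF m.
  exact: cvg_cst.
apply: eigen_on_dominated => // x dx x0.
have cx := cJ _ dx; have cTx := cJ _ (dominated_map _ dx).
apply/eqP; rewrite eq_le; apply/andP; split.
- have -> : t * J x = (t + 0) * J x by rewrite addr0.
  apply: (ler_cvg_to cTx (g := fun m => (t + harmonic m) * F_ m x)).
    by apply: cvgM => //; apply: cvgD => //; exact: cvg_cst.
  by apply: nearW => m; have [_ _ _ /(_ x dx x0)/andP[]] := aF m.
- have -> : t * J x = (t - 0) * J x - 0 * phi x by rewrite mul0r !subr0.
  apply: (ler_cvg_to _ cTx
    (f := fun m => (t - harmonic m) * F_ m x - harmonic m * phi x)).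
    apply: cvgB; last by apply: cvgM => //; exact: cvg_cst.
    by apply: cvgM => //; apply: cvgB => //; exact: cvg_cst.
  by apply: nearW => m; have [_ _ _ /(_ x dx x0)/andP[]] := aF m.
Qed.

End Orbit.

Theorem theorem1 (R : realType) (V : porderLmodType R) (T : {linear V -> V}) :
  nonsingular V -> positive_map T ->
  forall v : V, 0 <= v -> v != 0 -> has_ubound (iter_orbit T v) ->
    exists (J : V -> R) (t : R),
      [/\ positive_functional_on (orbit_ideal T v) J,
          0 <= t,
          (forall u : V, orbit_ideal T v u -> J (T u) = t * J u),
          J v = 1
        & t <= 1].
Proof.
move=> ns T0 v v0 vN0 [w wub].
have [phi [phi0 phiv]] := ns v v0 vN0.
pose f n := phi (iter n T v).
have f0 n : 0 <= f n by apply: phi0; exact: iter_ge0.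
have fB n : f n <= phi w.
  rewrite -subr_ge0 -linearB phi0 // subv_ge0.
  by apply: wub; exists n.
have f00 : 0 < f 0%N by rewrite lt_def f0 andbT.
pose t := inf (growth_ratios f).
have r1 := growth_ratios1 f (phi w) fB.
have lb0 : lbound (growth_ratios f) 0 by move=> s [/ltW].
have t0 : 0 <= t by apply: lb_le_inf => //; exists 1.
have t1 : t <= 1 by apply: ge_inf => //; exists 0.
have [|J [Jlin J0 Jv JT]] := @exists_eigen_of_approx _ _ T v T0 v0 phi t phi0 t0.
  move=> eps e0.
  have [mu slow] := exists_slow_weights _ f0 (phi w) eps f00 fB e0.
  by eexists; exact: (weighted_sum_approx_eigen T v T0 v0 phi phi0 t0 slow).
have dom := @orbit_ideal_dominated _ _ T v T0 v0.
exists J, t; split => //.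
- split; first by move=> a x y /dom dx /dom dy; exact: Jlin.
  by move=> x /dom; exact: J0.
- by move=> u /dom; exact: JT.
Qed.
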